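(* Let $X$ be a unital regular poly-bicategory, let $e: x \to x'$, $e': x' \to x''$, $e'': x \to x''$ be 1-cells of $X$, and let $p: (e,e') \to (e'')$ be a 2-cell of $X$ that satisfies two different universal properties, i.e. $p$ is universal at (at least) two of the three places $\partial_1^+$, $\partial_1^-$, $\partial_2^-$. If two of the three 1-cells $e$, $e'$, $e''$ are tensor universal, then the third is also tensor universal, and $p$ is everywhere universal (that is, universal at $\partial_1^+$, $\partial_1^-$ and $\partial_2^-$).
   Context: A regular 2-polygraph $X$ consists of a set of 0-cells, a set of 1-cells $a: x \to y$ (each with a source and a target 0-cell), and, for all $n,m\ge 1$, a set of 2-cells $p:(a_1,\ldots,a_n)\to(b_1,\ldots,b_m)$, whose input $(a_i)$ and output $(b_j)$ are non-empty composable sequences of 1-cells (the target of each is the source of the next) with the same initial source and the same final target; write $\partial_i^-p=a_i$, $\partial_j^+p=b_j$. Greek capitals denote possibly empty composable sequences of 1-cells, and commas denote concatenation. A (non-unital) regular poly-bicategory is a regular 2-polygraph with operations $\mathrm{cut}_{j,i}$: given $t:(\Gamma)\to(\Delta_1,a,\Delta_2)$ and $s:(\Gamma_1,a,\Gamma_2)\to(\Delta)$, where the displayed $a$ is the $j$-th output of $t$ and the $i$-th input of $s$, such that ($\Gamma_1$ or $\Delta_1$ is empty) and ($\Gamma_2$ or $\Delta_2$ is empty), there is a composite 2-cell $\mathrm{cut}_{j,i}(t,s):(\Gamma_1,\Gamma,\Gamma_2)\to(\Delta_1,\Delta,\Delta_2)$. These satisfy associativity and interchange: whenever three 2-cells can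 be composed by two cuts, along the same two identified 1-cells, in two different orders, the two results are equal (e.g. $\mathrm{cut}_{j,1}(t,\mathrm{cut}_{i,1}(s,r))=\mathrm{cut}_{i+j-1,1}(\mathrm{cut}_{j,1}(t,s),r)$). No unit cells are part of the structure. Universality. A 2-cell $t:(\Gamma)\to(\Delta_1,a,\Delta_2)$, with $a$ in $j$-th position, is universal at $\partial_j^+$ if for all $\Gamma_1,\Gamma_2$ and non-empty $\Delta$ with ($\Gamma_1$ or $\Delta_1$ empty) and ($\Gamma_2$ or $\Delta_2$ empty), every 2-cell $s:(\Gamma_1,\Gamma,\Gamma_2)\to(\Delta_1,\Delta,\Delta_2)$ equals $\mathrm{cut}(t,r)$, composed along $a$, for a unique $r:(\Gamma_1,a,\Gamma_2)\to(\Delta)$. Dually, $t:(\Gamma_1,a,\Gamma_2)\to(\Delta)$, with $a$ in $i$-th position, is universal at $\partial_i^-$ if for all $\Delta_1,\Delta_2$ and non-empty $\Gamma$ with ($\Gamma_1$ or $\Delta_1$ empty) and ($\Gamma_2$ or $\Delta_2$ empty), every $s:(\Gamma_1,\Gamma,\Gamma_2)\to(\Delta_1,\Delta,\Delta_2)$ equals $\mathrm{cut}(r,t)$, composed along $a$, for a unique $r:(\Gamma)\to(\Delta_1,a,\Delta_2)$. A 2-cell is everywhere universal if it is universal at every input and every output. A unit on a 1-cell $a$ is a 2-cell $\mathrm{id}_a:(a)\to(a)$ such that every cut with $\mathrm{id}_a$, on either side, returns the other 2-cell. $X$ is unital if every 1-cell has a unit. Tensor universality. Let $e: x \to x'$ be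 a 1-cell. It is tensor left universal if for each 1-cell $a: x\to y$ there exist a 1-cell $u: x'\to y$ and a 2-cell $(e,u)\to(a)$ universal at both $\partial_1^+$ and $\partial_2^-$, and for each 1-cell $a':x'\to y$ there exist a 1-cell $v: x\to y$ and a 2-cell $(e,a')\to(v)$ universal at both $\partial_1^+$ and $\partial_2^-$. It is tensor right universal if for each $b': z\to x'$ there exist $u: z\to x$ and a 2-cell $(u,e)\to(b')$ universal at both $\partial_1^+$ and $\partial_1^-$, and for each $b:z\to x$ there exist $v: z\to x'$ and a 2-cell $(b,e)\to(v)$ universal at both $\partial_1^+$ and $\partial_1^-$. It is tensor universal if it is both tensor left and tensor right universal. *)

(* Defs.v *)
From mathcomp Require Import all_boot.

Set Implicit Arguments.
Unset Strict Implicit.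
Unset Printing Implicit Defensive.

(* The 2-cells form a single type, with their input and output sequences as
   functions (rather than a family indexed by pairs of sequences), so that
   composites whose boundaries agree only up to associativity of
   concatenation can be compared with plain equality. *)

Section Composable.
Variables (C0 C1 : Type) (src tgt : C1 -> C0).

Fixpoint composable (x : C0) (s : seq C1) (y : C0) : Prop :=
  if s is a :: s' then src a = x /\ composable (tgt a) s' y else x = y.

End Composable.

Record polygraph := Polygraph {
  cell0 : Type;
  cell1 : Type;
  cell2 : Type;
  src : cell1 -> cell0;
  tgt : cell1 -> cell0;
  inp : cell2 -> seq cell1;
  out : cell2 -> seq cell1;
  inp_neq0 : forall p, inp p <> [::];
  out_neq0 : forall p, out p <> [::];
  inp_out_parallel : forall p, exists x y,
    composable src tgt x (inp p) y /\ composable src tgt x (out p) y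
}.

Section PolygraphDefs.
Variable X : polygraph.

Definition is_1cell (a : cell1 X) (x y : cell0 X) := src a = x /\ tgt a = y.

Definition is_2cell (p : cell2 X) (Γ Δ : seq (cell1 X)) :=
  inp p = Γ /\ out p = Δ.

(* Positions are counted from 1. *)
Definition splits (s : seq (cell1 X)) (i : nat) (s1 : seq (cell1 X))
    (a : cell1 X) (s2 : seq (cell1 X)) :=
  s = s1 ++ a :: s2 /\ i = (size s1).+1.

Definition one_empty (Γ Δ : seq (cell1 X)) := Γ = [::] \/ Δ = [::].

Definition cuttable (j i : nat) (t s : cell2 X) :=
  exists Δ1 Δ2 Γ1 Γ2 a,
    [/\ splits (out t) j Δ1 a Δ2, splits (inp s) i Γ1 a Γ2,
        one_empty Γ1 Δ1 & one_empty Γ2 Δ2].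

End PolygraphDefs.

(* The partial operation cut_{j,i} is encoded as a total function whose values
   at (j, i, t, s) with ~ cuttable j i t s are irrelevant: every axiom
   and definition below only involves cuts that are defined.

   In a composite of three 2-cells by two cuts, one of the cells is cut with
   each of the other two, along two distinct 1-cells of its boundary. These
   are an input and an output (cut_assoc), two outputs (cut_interchange_out),
   or two inputs (cut_interchange_in). *)
Record polyBicategory := PolyBicategory {
  pb_polygraph :> polygraph;
  cut : nat -> nat ->
    cell2 pb_polygraph -> cell2 pb_polygraph -> cell2 pb_polygraph;
  cut_boundary : forall j i t s Δ1 Δ2 Γ1 Γ2 a,
    splits (out t) j Δ1 a Δ2 -> splits (inp s) i Γ1 a Γ2 ->
    one_empty Γ1 Δ1 -> one_empty Γ2 Δ2 ->
    is_2cell (cut j i t s) (Γ1 ++ inp t ++ Γ2) (Δ1 ++ out s ++ Δ2);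
  cut_assoc : forall j i k l t s r,
    cuttable j i t s -> cuttable (j + k).-1 l (cut j i t s) r ->
    cuttable k l s r -> cuttable j (l + i).-1 t (cut k l s r) ->
    cut j (l + i).-1 t (cut k l s r) = cut (j + k).-1 l (cut j i t s) r;
  cut_interchange_out : forall j i k l t s r, j < k ->
    cuttable j i t s -> cuttable (k + size (out s)).-1 l (cut j i t s) r ->
    cuttable k l t r -> cuttable j i (cut k l t r) s ->
    cut (k + size (out s)).-1 l (cut j i t s) r = cut j i (cut k l t r) s;
  cut_interchange_in : forall j i k l t s r, i < l ->
    cuttable j i t r -> cuttable k (l + size (inp t)).-1 s (cut j i t r) ->
    cuttable k l s r -> cuttable j i t (cut k l s r) ->
    cut k (l + size (inp t)).-1 s (cut j i t r) = cut j i t (cut k l s r)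
}.

Section PolyBicategoryDefs.
Variable X : polyBicategory.
Implicit Types (a e : cell1 X) (t : cell2 X).

Definition universal_out (j : nat) t :=
  exists Δ1 a Δ2, splits (out t) j Δ1 a Δ2 /\
    forall (Γ1 Γ2 Δ : seq (cell1 X)) s,
      Δ <> [::] -> one_empty Γ1 Δ1 -> one_empty Γ2 Δ2 ->
      is_2cell s (Γ1 ++ inp t ++ Γ2) (Δ1 ++ Δ ++ Δ2) ->
      exists! r, is_2cell r (Γ1 ++ a :: Γ2) Δ /\ s = cut j (size Γ1).+1 t r.

Definition universal_in (i : nat) t :=
  exists Γ1 a Γ2, splits (inp t) i Γ1 a Γ2 /\
    forall (Δ1 Δ2 Γ : seq (cell1 X)) s,
      Γ <> [::] -> one_empty Γ1 Δ1 -> one_empty Γ2 Δ2 ->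
      is_2cell s (Γ1 ++ Γ ++ Γ2) (Δ1 ++ out t ++ Δ2) ->
      exists! r, is_2cell r Γ (Δ1 ++ a :: Δ2) /\ s = cut (size Δ1).+1 i r t.

Definition everywhere_universal t :=
  (forall i, 1 <= i <= size (inp t) -> universal_in i t) /\
  (forall j, 1 <= j <= size (out t) -> universal_out j t).

Definition is_unit a (u : cell2 X) :=
  [/\ is_2cell u [:: a] [:: a],
      forall j i s, cuttable j i u s -> cut j i u s = s
    & forall j i t, cuttable j i t u -> cut j i t u = t].

Definition unital := forall a, exists u, is_unit a u.

Definition tensor_left_universal e :=
  (forall y a, is_1cell a (src e) y ->
     exists u p, [/\ is_1cell u (tgt e) y, is_2cell p [:: e; u] [:: a],
                     universal_out 1 p & universal_in 2 p]) /\
  (forall y a', is_1cell a' (tgt e) y ->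
     exists v p, [/\ is_1cell v (src e) y, is_2cell p [:: e; a'] [:: v],
                     universal_out 1 p & universal_in 2 p]).

Definition tensor_right_universal e :=
  (forall z b', is_1cell b' z (tgt e) ->
     exists u p, [/\ is_1cell u z (src e), is_2cell p [:: u; e] [:: b'],
                     universal_out 1 p & universal_in 1 p]) /\
  (forall z b, is_1cell b z (src e) ->
     exists v p, [/\ is_1cell v z (tgt e), is_2cell p [:: b; e] [:: v],
                     universal_out 1 p & universal_in 1 p]).

Definition tensor_universal e :=
  tensor_left_universal e /\ tensor_right_universal e.

End PolyBicategoryDefs.

Definition two_of_three (P Q R : Prop) := [\/ P /\ Q, P /\ R | Q /\ R].

(* Main.v *)
Require Import Defs.
From mathcomp Require Import all_boot.
From mathcomp Require Import zify.

Set Implicit Arguments.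
Unset Strict Implicit.
Unset Printing Implicit Defensive.

(** The theorem is read off from bijections between sets of 2-cells. Write
    hom Γ Δ for the 2-cells from Γ to Δ. A 2-cell with a single output is
    universal at that output, or at an input, exactly when cutting with it is
    a bijection between the homs of every admissible context
    ([universal_out1P], [universal_inP]). Associativity and interchange turn
    into commuting triangles and squares of such maps, so every universal
    property that is claimed below follows by cancelling bijections
    ([bij_comp], [bij_cancel_pre], [bij_cancel_post]).

    All the universal properties of p reduce to the one at its output. If e is
    tensor left universal, compare p : (e,e') -> (e'') with a 2-cell of the
    same e that is universal both at its output and at its second input, and
    has the same other input, or the same output. The two differ by a 2-cell
    between single 1-cells, and for such a 2-cell universality at the input,
    universality at the output and invertibility coincide, thanks to the
    units. Hence p is universal at the second input if and only if it is at
    the output ([universal_in2_iff_out]); mirror-symmetrically, if e' is tensor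
    right universal the first input and the output are equivalent. Whichever
    two 1-cells are tensor universal, and whichever two universal properties
    p has, at least one of these equivalences applies, or p is universal at
    its output to start with.

    It remains to see that, for p universal at the output, so that e'' plays
    the part of a tensor product of e and e', tensor universal 1-cells have
    the two-out-of-three property.
    - From e and e' to e'': dividing or multiplying by e'' is done by e and e'
      in succession, and the resulting 2-cell (e,e',w) -> (a) factors through
      p ([left_biuniversal_comp]).
    - From e and e'' to e': given 2-cells (e'',w) -> (b) and (e,a) -> (b),
      the cut of the first with p factors through the second as a 2-cell
      (e',w) -> (a). Its universality has to be shown in contexts where e does
      not occur; there e is inserted by means of its own universality
      ([universal_out_cancel], [right_biuniversal_cancel]). At the
      output this takes both sides: the 1-cell before the inputs of the cell is
      divided by e if there is one, and otherwise the first output is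
      multiplied by e.
    - From e' and e'' to e: this is the previous case in the poly-bicategory
      with all sequences reversed ([mirror]). *)

(** * Bijections between predicates *)

Section Bijections.
Variable T : Type.
Implicit Types (P Q R : T -> Prop) (f g h : T -> T).

Definition bij_between P Q f :=
  (forall r, P r -> Q (f r)) /\
  (forall s, Q s -> exists! r, P r /\ s = f r).

Lemma bij_inj P Q f r r' :
  bij_between P Q f -> P r -> P r' -> f r = f r' -> r = r'.
Proof.
move=> [fPQ fbij] Pr Pr' eqf.
have [r0 [_ r0_uniq]] := fbij _ (fPQ _ Pr).
by rewrite -(r0_uniq r) // (r0_uniq r').
Qed.

Lemma bij_surj P Q f s : bij_between P Q f -> Q s -> exists2 r, P r & s = f r.
Proof. by move=> [_ fbij] /fbij[r [[Pr ->] _]]; exists r. Qed.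

Lemma bij_between_intro P Q f :
  (forall r, P r -> Q (f r)) ->
  (forall r r', P r -> P r' -> f r = f r' -> r = r') ->
  (forall s, Q s -> exists2 r, P r & s = f r) -> bij_between P Q f.
Proof.
move=> fPQ finj fsurj; split=> // s /fsurj[r Pr ->].
by exists r; split=> // r' [Pr' /finj]; apply.
Qed.

(** 2-cells in the target carry typing information: when a hom is given by
    sequences that may fail to be composable, this reduces bijectivity to the
    case where they are. *)
Lemma bij_between_of_inhabited P Q f :
  (forall r, P r -> Q (f r)) -> ((exists s, Q s) -> bij_between P Q f) ->
  bij_between P Q f.
Proof.
move=> fPQ fbij; split=> // s Qs; apply: (fbij _).2 => //; by exists s.
Qed.

Lemma bij_between_ext P P' Q Q' f f' :
  (forall r, P r <-> P' r) -> (forall s, Q s <-> Q' s) ->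
  (forall r, P r -> f r = f' r) -> bij_between P Q f <-> bij_between P' Q' f'.
Proof.
move=> PP' QQ' ff'; split=> fbij; have [fPQ _] := fbij.
  apply: bij_between_intro => [r|r r'|s].
  - by rewrite -PP' -QQ' => Pr; rewrite -ff' //; apply: fPQ.
  - by rewrite -!PP' => Pr Pr'; rewrite -!ff' //; apply: (bij_inj fbij).
  rewrite -QQ' => /(bij_surj fbij)[r Pr ->].
  by exists r; [rewrite -PP' | apply: ff'].
apply: bij_between_intro => [r Pr|r r' Pr Pr'|s].
- by rewrite QQ' ff' //; apply/fPQ/PP'.
- by rewrite !ff' //; apply: (bij_inj fbij); apply/PP'.
rewrite QQ' => /(bij_surj fbij)[r /PP' Pr ->].
by exists r => //; rewrite ff'.
Qed.

Lemma bij_comp P Q R f g h :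
  bij_between P Q f -> bij_between Q R g ->
  (forall r, P r -> h r = g (f r)) -> bij_between P R h.
Proof.
move=> fbij gbij hE; have [fPQ _] := fbij; have [gQR _] := gbij.
apply: bij_between_intro => [r Pr|r r' Pr Pr'|s Rs].
- by rewrite hE //; apply/gQR/fPQ.
- rewrite !hE // => /(bij_inj gbij) eqf.
  by apply: (bij_inj fbij) => //; apply: eqf; apply: fPQ.
have [r' Qr' ->] := bij_surj gbij Rs.
have [r Pr ->] := bij_surj fbij Qr'.
by exists r; rewrite ?hE.
Qed.

Lemma bij_cancel_pre P Q R f g h :
  bij_between P Q f -> bij_between P R h ->
  (forall r, P r -> h r = g (f r)) -> bij_between Q R g.
Proof.
move=> fbij hbij hE; have [hPR _] := hbij; have [fPQ _] := fbij.
apply: bij_between_intro => [r Qr|r r' Qr Qr'|s Rs].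
- by have [r0 Pr0 ->] := bij_surj fbij Qr; rewrite -hE //; apply: hPR.
- have [r0 Pr0 ->] := bij_surj fbij Qr; have [r1 Pr1 ->] := bij_surj fbij Qr'.
  by rewrite -!hE // => /(bij_inj hbij)->.
have [r Pr ->] := bij_surj hbij Rs.
by exists (f r); rewrite ?hE //; apply: fPQ.
Qed.

Lemma bij_cancel_post P Q R f g h :
  (forall r, P r -> Q (f r)) -> bij_between Q R g -> bij_between P R h ->
  (forall r, P r -> h r = g (f r)) -> bij_between P Q f.
Proof.
move=> fPQ gbij hbij hE; have [gQR _] := gbij.
apply: bij_between_intro => // [r r' Pr Pr' eqf|s Qs].
  by apply: (bij_inj hbij) => //; rewrite !hE ?eqf.
have [r Pr eqg] := bij_surj hbij (gQR _ Qs); exists r => //.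
by apply: (bij_inj gbij) => //; [apply: fPQ | rewrite eqg hE].
Qed.

End Bijections.

Local Notation hom Γ Δ := (fun r => is_2cell r Γ Δ).

(** * Cuts and contexts *)

Section Cuts.
Variable X : polyBicategory.
Implicit Types (a b c e : cell1 X) (t s r p q : cell2 X).
Implicit Types (Γ Δ A B C D E Θ : seq (cell1 X)).

Lemma one_empty_nill Γ : one_empty [::] Γ. Proof. by left. Qed.
Lemma one_empty_nilr Γ : one_empty Γ [::]. Proof. by right. Qed.
Lemma one_empty_cat Γ Γ' Δ :
  one_empty Γ Δ -> one_empty Γ' Δ -> one_empty (Γ ++ Γ') Δ.
Proof. by case=> [->|->] // _; right. Qed.
Lemma one_empty_catr Γ Δ Δ' :
  one_empty Γ Δ -> one_empty Γ Δ' -> one_empty Γ (Δ ++ Δ').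
Proof. by case=> [->|->] // _; left. Qed.

Lemma cut_2cell t s Θ D1 a D2 C1 C2 Δ :
  is_2cell t Θ (D1 ++ a :: D2) -> is_2cell s (C1 ++ a :: C2) Δ ->
  one_empty C1 D1 -> one_empty C2 D2 ->
  is_2cell (cut (size D1).+1 (size C1).+1 t s)
    (C1 ++ Θ ++ C2) (D1 ++ Δ ++ D2).
Proof.
by move=> [<- out_t] [inp_s <-] o1 o2; apply: (cut_boundary (a := a)).
Qed.

Lemma cuttable_ctx t s Θ D1 a D2 C1 C2 Δ :
  is_2cell t Θ (D1 ++ a :: D2) -> is_2cell s (C1 ++ a :: C2) Δ ->
  one_empty C1 D1 -> one_empty C2 D2 ->
  cuttable (size D1).+1 (size C1).+1 t s.
Proof. by move=> [_ out_t] [inp_s _] o1 o2; exists D1, D2, C1, C2, a. Qed.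

(** Stated on contexts rather than on positions, associativity needs no
    cuttability hypothesis for the composites: the six emptiness conditions
    on the contexts imply them. *)
Lemma cut_assoc_ctx t s r Θ D1 a D2 A1 A2 B1 b B2 C1 C2 E :
  is_2cell t Θ (D1 ++ a :: D2) ->
  is_2cell s (A1 ++ a :: A2) (B1 ++ b :: B2) ->
  is_2cell r (C1 ++ b :: C2) E ->
  one_empty A1 D1 -> one_empty A2 D2 ->
  one_empty C1 B1 -> one_empty C2 B2 ->
  one_empty C1 D1 -> one_empty C2 D2 ->
  cut (size D1).+1 (size C1 + size A1).+1 t
      (cut (size B1).+1 (size C1).+1 s r) =
  cut (size D1 + size B1).+1 (size C1).+1
      (cut (size D1).+1 (size A1).+1 t s) r.
Proof.
move=> tP sP rP oAD1 oAD2 oCB1 oCB2 oCD1 oCD2.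
have ts := cut_2cell tP sP oAD1 oAD2; have sr := cut_2cell sP rP oCB1 oCB2.
have := @cut_assoc X (size D1).+1 (size A1).+1 (size B1).+1 (size C1).+1 t s r.
rewrite !addSn !addnS /= => -> //.
- exact: cuttable_ctx tP sP _ _.
- rewrite -size_cat; apply: (cuttable_ctx (a := b) (D2 := B2 ++ D2)).
  + by rewrite -catA /=; move: ts; rewrite -catA; apply.
  + exact: rP.
  + exact: one_empty_catr.
  + exact: one_empty_catr.
- exact: cuttable_ctx sP rP _ _.
- rewrite -size_cat; apply: (cuttable_ctx (a := a) (C2 := A2 ++ C2)).
  + exact: tP.
  + by rewrite -catA /=; move: sr; rewrite -catA; apply.
  + exact: one_empty_cat.
  + exact: one_empty_cat.
Qed.

(** Two cells are cut into distinct inputs of r. The left one may have further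
    outputs only before a, the right one only after b, which is what
    planarity leaves. *)
Lemma cut_interchange_ctx t s r Θ Θ' D1 a D2 b A1 A2 A3 E :
  is_2cell t Θ (D1 ++ [:: a]) -> is_2cell s Θ' (b :: D2) ->
  is_2cell r (A1 ++ a :: A2 ++ b :: A3) E ->
  one_empty A1 D1 -> one_empty A3 D2 ->
  cut 1 (size A1 + size Θ + size A2).+1 s
      (cut (size D1).+1 (size A1).+1 t r) =
  cut (size D1).+1 (size A1).+1 t
      (cut 1 (size A1 + (size A2).+1).+1 s r).
Proof.
move=> tP sP rP oAD1 oAD3.
have tr := cut_2cell tP rP oAD1 (one_empty_nilr _).
have rP' : is_2cell r ((A1 ++ a :: A2) ++ b :: A3) E by rewrite -catA.
have sr := cut_2cell (D1 := [::]) sP rP' (one_empty_nilr _) oAD3.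
have := @cut_interchange_in X (size D1).+1 (size A1).+1 1
  (size A1 + (size A2).+1).+1 t s r.
have [-> _] := tP.
have -> : ((size A1 + (size A2).+1).+1 + size Θ).-1 =
   (size A1 + size Θ + size A2).+1 by lia.
move=> -> //; first by lia.
- exact: cuttable_ctx tP rP _ (one_empty_nilr _).
- have -> : size A1 + size Θ + size A2 = size (A1 ++ Θ ++ A2).
    by rewrite !size_cat addnA.
  apply: (cuttable_ctx (D1 := [::]) (a := b)) oAD3 => //; first exact: sP.
  + by rewrite -!catA; exact: tr.
  + exact: one_empty_nilr.
- have -> : size A1 + (size A2).+1 = size (A1 ++ a :: A2) by rewrite size_cat.
  exact: (cuttable_ctx (D1 := [::])) sP rP' (one_empty_nilr _) oAD3.
- apply: cuttable_ctx tP _ oAD1 (one_empty_nilr _).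
  by move: sr; rewrite -!catA /= size_cat /=; apply.
Qed.

(** * Universality as bijectivity of cuts *)

Lemma cat_cons_inj A a B A' a' B' : size A = size A' ->
  A ++ a :: B = A' ++ a' :: B' -> [/\ A = A', a = a' & B = B'].
Proof.
elim: A A' => [|x A IH] [|x' A'] //=; first by move=> _ [-> ->].
by move=> [/IH{}IH] [-> /IH[-> -> ->]].
Qed.

(** With a single output the contexts on the output side are empty, so the
    inputs on both sides are unrestricted. *)
Lemma universal_out1P t Θ a : is_2cell t Θ [:: a] ->
  universal_out 1 t <-> forall Γ1 Γ2 Δ, Δ <> [::] ->
    bij_between (hom (Γ1 ++ a :: Γ2) Δ) (hom (Γ1 ++ Θ ++ Γ2) Δ)
                (cut 1 (size Γ1).+1 t).
Proof.
move=> tP; have [inp_t out_t] := tP; split.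
  case=> D1 [a' [D2 [[Dt D1E] tU]]] Γ1 Γ2 Δ Δ0.
  case: D1E => /esym/size0nil D1E; rewrite D1E out_t in Dt tU.
  case: Dt => ? ?; subst a' D2; split=> [r rP|s sP].
    have := cut_2cell (D1 := [::]) tP rP (one_empty_nilr _) (one_empty_nilr _).
    by rewrite cats0.
  apply: tU; rewrite ?cats0 ?inp_t //; exact: one_empty_nilr.
move=> tU; exists [::], a, [::]; split=> // Γ1 Γ2 Δ s Δ0 _ _.
by rewrite /= cats0 inp_t; apply: (tU _ _ _ _).2.
Qed.

Lemma universal_inP t A1 a A2 Δ : is_2cell t (A1 ++ a :: A2) Δ ->
  universal_in (size A1).+1 t <-> forall D1 D2 Γ, Γ <> [::] ->
    one_empty A1 D1 -> one_empty A2 D2 ->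
    bij_between (hom Γ (D1 ++ a :: D2)) (hom (A1 ++ Γ ++ A2) (D1 ++ Δ ++ D2))
      (fun r => cut (size D1).+1 (size A1).+1 r t).
Proof.
move=> tP; have [inp_t out_t] := tP; split.
  case=> B1 [a' [B2 [[Dt B1E] tU]]] D1 D2 Γ Γ0 o1 o2.
  case: B1E => sizeE; move: Dt; rewrite inp_t => /(cat_cons_inj sizeE)[? ? ?].
  subst B1 a' B2.
  split=> [r rP|s]; first exact: cut_2cell rP tP o1 o2.
  by rewrite -out_t; apply: tU.
move=> tU; exists A1, a, A2; split=> // D1 D2 Γ s Γ0 o1 o2.
by rewrite out_t; apply: (tU _ _ _ _ _ _).2.
Qed.


Lemma universal_in2P t c a b : is_2cell t [:: c; a] [:: b] ->
  universal_in 2 t <-> forall D Γ, Γ <> [::] ->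
    bij_between (hom Γ (a :: D)) (hom (c :: Γ) (b :: D))
      (fun r => cut 1 2 r t).
Proof.
move=> tP; rewrite (universal_inP (A1 := [:: c]) (A2 := [::]) tP).
split=> [tU D Γ Γ0|tU D1 D2 Γ Γ0 [//|->] _]; last first.
  by rewrite /= cats0; apply: tU.
have := tU [::] D Γ Γ0 (one_empty_nilr _) (one_empty_nill _).
by rewrite /= cats0.
Qed.

Lemma universal_in1P t a c b : is_2cell t [:: a; c] [:: b] ->
  universal_in 1 t <-> forall D Γ, Γ <> [::] ->
    bij_between (hom Γ (D ++ [:: a])) (hom (Γ ++ [:: c]) (D ++ [:: b]))
      (fun r => cut (size D).+1 1 r t).
Proof.
move=> tP; rewrite (universal_inP (A1 := [::]) (A2 := [:: c]) tP).
split=> tU.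
  by move=> D Γ Γ0; apply: tU; [|apply: one_empty_nill|apply: one_empty_nilr].
by move=> D1 D2 Γ Γ0 _ [//|->]; apply: tU.
Qed.

Lemma universal_in_unaryP t a b : is_2cell t [:: a] [:: b] ->
  universal_in 1 t <-> forall D1 D2 Γ, Γ <> [::] ->
    bij_between (hom Γ (D1 ++ a :: D2)) (hom Γ (D1 ++ b :: D2))
      (fun r => cut (size D1).+1 1 r t).
Proof.
move=> tP; rewrite (universal_inP (A1 := [::]) (A2 := [::]) tP).
split=> tU D1 D2 Γ Γ0.
  have := tU D1 D2 Γ Γ0 (one_empty_nill _) (one_empty_nill _).
  by rewrite /= cats0.
by rewrite /= cats0 => _ _; apply: tU.
Qed.

(** * Composition along a single output *)

Lemma comp_2cell t q Θ a A1 A2 Δ :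
  is_2cell t Θ [:: a] -> is_2cell q (A1 ++ a :: A2) Δ ->
  is_2cell (cut 1 (size A1).+1 t q) (A1 ++ Θ ++ A2) Δ.
Proof.
move=> tP qP; have := cut_2cell (D1 := [::]) tP qP (one_empty_nilr _).
by move=> /(_ (one_empty_nilr _)); rewrite /= cats0.
Qed.

Lemma comp_assoc t q r Θ a A1 A2 b Γ1 Γ2 Δ :
  is_2cell t Θ [:: a] -> is_2cell q (A1 ++ a :: A2) [:: b] ->
  is_2cell r (Γ1 ++ b :: Γ2) Δ ->
  cut 1 (size (Γ1 ++ A1)).+1 t (cut 1 (size Γ1).+1 q r) =
  cut 1 (size Γ1).+1 (cut 1 (size A1).+1 t q) r.
Proof.
move=> tP qP rP; rewrite size_cat.
by apply: (cut_assoc_ctx (D1 := [::]) (B1 := [::]) tP qP rP);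
  exact: one_empty_nilr.
Qed.

(** Cutting with t in the context of q is one of the bijections given by the
    universality of t, and cutting with the composite is cutting with q and
    then with t. *)
Lemma universal_out_comp t q Θ a A1 A2 b :
  is_2cell t Θ [:: a] -> is_2cell q (A1 ++ a :: A2) [:: b] ->
  universal_out 1 t ->
  universal_out 1 q <-> universal_out 1 (cut 1 (size A1).+1 t q).
Proof.
move=> tP qP /(universal_out1P tP) tU; have tqP := comp_2cell tP qP.
rewrite (universal_out1P qP) (universal_out1P tqP).
have key Γ1 Γ2 Δ : Δ <> [::] -> 
    bij_between (hom (Γ1 ++ (A1 ++ a :: A2) ++ Γ2) Δ)
      (hom (Γ1 ++ (A1 ++ Θ ++ A2) ++ Γ2) Δ) (cut 1 (size (Γ1 ++ A1)).+1 t).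
  by move=> /(tU (Γ1 ++ A1) (A2 ++ Γ2)); rewrite -!catA.
split=> U Γ1 Γ2 Δ Δ0.
  apply: bij_comp (U Γ1 Γ2 Δ Δ0) (key Γ1 Γ2 Δ Δ0) _ => r rP.
  by rewrite (comp_assoc tP qP rP).
apply: bij_cancel_post (key Γ1 Γ2 Δ Δ0) (U Γ1 Γ2 Δ Δ0) _ => r rP.
  by apply: comp_2cell qP rP.
by rewrite (comp_assoc tP qP rP).
Qed.

Lemma universal_out_factor t Θ a Γ1 Γ2 Δ s :
  is_2cell t Θ [:: a] -> universal_out 1 t -> Δ <> [::] ->
  is_2cell s (Γ1 ++ Θ ++ Γ2) Δ ->
  exists2 r, is_2cell r (Γ1 ++ a :: Γ2) Δ & s = cut 1 (size Γ1).+1 t r.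
Proof.
by move=> tP /(universal_out1P tP)U Δ0; apply: bij_surj (U _ _ _ Δ0).
Qed.

(** * Invertible 2-cells *)

Definition invertible f a b := exists g ia ib, [/\ is_2cell g [:: b] [:: a],
  is_unit a ia, is_unit b ib, cut 1 1 f g = ia & cut 1 1 g f = ib].

Lemma unit_2cell a u : is_unit a u -> is_2cell u [:: a] [:: a].
Proof. by case. Qed.

Lemma cut_unit_in a u s Γ1 Γ2 Δ : is_unit a u ->
  is_2cell s (Γ1 ++ a :: Γ2) Δ -> cut 1 (size Γ1).+1 u s = s.
Proof.
move=> [uP uL _] sP; apply: uL.
by apply: (cuttable_ctx (D1 := [::])) uP sP _ _; exact: one_empty_nilr.
Qed.

Lemma cut_unit_out a u s Γ D1 D2 : is_unit a u ->
  is_2cell s Γ (D1 ++ a :: D2) -> cut (size D1).+1 1 s u = s.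
Proof.
move=> [uP _ uR] sP; apply: uR.
by apply: (cuttable_ctx (C1 := [::])) sP uP _ _; exact: one_empty_nill.
Qed.

(** The inverse is the factor of the unit on a through f; that it is also an
    inverse on the other side is uniqueness of the factor of f through
    itself. *)
Lemma universal_out_invertible f a b : unital X -> is_2cell f [:: a] [:: b] ->
  universal_out 1 f -> invertible f a b.
Proof.
move=> unitX fP fU; have [ia iaP] := unitX a; have [ib ibP] := unitX b.
have [iaC ibC] := (unit_2cell iaP, unit_2cell ibP).
have [//|g gP fg] := universal_out_factor (Γ1 := [::]) (Γ2 := [::]) fP fU _ iaC.
exists g, ia, ib; split=> //.
apply: (bij_inj ((universal_out1P fP).1 fU [::] [::] [:: b] _)) => //.
  by have := comp_2cell (A1 := [::]) (A2 := [::]) gP fP.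
have /= -> := comp_assoc (A1 := [::]) (Γ1 := [::]) (A2 := [::]) (Γ2 := [::])
  fP gP fP.
by rewrite -fg (cut_unit_in (Γ1 := [::]) (Γ2 := [::]) iaP fP)
  (cut_unit_out (D1 := [::]) (D2 := [::]) ibP fP).
Qed.

(** The hypothesis is weaker than universality at the input, as it has no
    context on the output side. In [universal_in2_out] this matters: there f is
    compared with 2-cells having e before the relevant input, and their
    universality allows no outputs before b. *)
Lemma invertible_of_bij_postcomp f a b : unital X -> is_2cell f [:: a] [:: b] ->
  (forall Γ, Γ <> [::] ->
     bij_between (hom Γ [:: a]) (hom Γ [:: b]) (fun r => cut 1 1 r f)) ->
  invertible f a b.
Proof.
move=> unitX fP fU; have [ia iaP] := unitX a; have [ib ibP] := unitX b.
have [iaC ibC] := (unit_2cell iaP, unit_2cell ibP).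
have [//|g gP gf] := bij_surj (fU [:: b] _) ibC.
exists g, ia, ib; split=> //.
apply: (bij_inj (fU [:: a] _)) => //.
  by have := comp_2cell (A1 := [::]) (A2 := [::]) fP gP.
have /= <- := comp_assoc (A1 := [::]) (Γ1 := [::]) (A2 := [::]) (Γ2 := [::])
  fP gP fP.
by rewrite -gf (cut_unit_in (Γ1 := [::]) (Γ2 := [::]) iaP fP)
  (cut_unit_out (D1 := [::]) (D2 := [::]) ibP fP).
Qed.

Lemma invertible_universal_out f a b : is_2cell f [:: a] [:: b] ->
  invertible f a b -> universal_out 1 f.
Proof.
move=> fP [g [ia [ib [gP iaP ibP fg gf]]]]; apply/(universal_out1P fP).
move=> Γ1 Γ2 Δ Δ0; apply: bij_between_intro => [r rP|r r' rP r'P eqfr|s sP].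
- exact: comp_2cell fP rP.
- have cancel s : is_2cell s (Γ1 ++ b :: Γ2) Δ ->
      cut 1 (size Γ1).+1 g (cut 1 (size Γ1).+1 f s) = s.
    move=> sP; have := comp_assoc (A1 := [::]) (A2 := [::]) gP fP sP.
    by rewrite cats0 /= gf (cut_unit_in ibP sP).
  by rewrite -(cancel r) // eqfr cancel.
exists (cut 1 (size Γ1).+1 g s); first exact: comp_2cell gP sP.
have := comp_assoc (A1 := [::]) (A2 := [::]) fP gP sP.
by rewrite cats0 /= fg (cut_unit_in iaP sP).
Qed.

Lemma cut_assoc_unary t q r Θ a b c D1 D2 :
  is_2cell t Θ (D1 ++ a :: D2) -> is_2cell q [:: a] [:: b] ->
  is_2cell r [:: b] [:: c] ->
  cut (size D1).+1 1 (cut (size D1).+1 1 t q) r =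
  cut (size D1).+1 1 t (cut 1 1 q r).
Proof.
move=> tP qP rP; rewrite -{1}[size D1]addn0.
by apply/esym/(cut_assoc_ctx (A1 := [::]) (A2 := [::]) (B1 := [::])
  (B2 := [::]) (C1 := [::]) (C2 := [::]) tP qP rP); exact: one_empty_nill.
Qed.

Lemma cut_2cell_unary t q Θ a b D1 D2 :
  is_2cell t Θ (D1 ++ a :: D2) -> is_2cell q [:: a] [:: b] ->
  is_2cell (cut (size D1).+1 1 t q) Θ (D1 ++ b :: D2).
Proof.
move=> tP qP.
have := cut_2cell (C1 := [::]) (C2 := [::]) tP qP (one_empty_nill _).
by move=> /(_ (one_empty_nill _)); rewrite /= cats0.
Qed.

Lemma invertible_universal_in f a b : is_2cell f [:: a] [:: b] ->
  invertible f a b -> universal_in 1 f.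
Proof.
move=> fP [g [ia [ib [gP iaP ibP fg gf]]]]; apply/(universal_in_unaryP fP).
move=> D1 D2 Γ Γ0; apply: bij_between_intro => [r rP|r r' rP r'P eqfr|s sP].
- exact: cut_2cell_unary rP fP.
- have cancel s : is_2cell s Γ (D1 ++ a :: D2) ->
      cut (size D1).+1 1 (cut (size D1).+1 1 s f) g = s.
    by move=> sP; rewrite (cut_assoc_unary sP fP gP) fg (cut_unit_out iaP sP).
  by rewrite -(cancel r) // eqfr cancel.
exists (cut (size D1).+1 1 s g); first exact: cut_2cell_unary sP gP.
by rewrite (cut_assoc_unary sP gP fP) gf (cut_unit_out ibP sP).
Qed.


(** * Tensor universality and the universal properties of one 2-cell *)

Lemma binary_boundary p e a b : is_2cell p [:: e; a] [:: b] ->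
  [/\ src a = tgt e, src b = src e & tgt b = tgt a].
Proof.
move=> [pI pO]; have [x [y []]] := inp_out_parallel p; rewrite pI pO /=.
by move=> [-> [-> ->]] [-> ->].
Qed.

(** Both p and the chosen universal q : (e,a) -> (v) are universal at the
    output, so they differ by an invertible f : (v) -> (b), and cutting with
    f preserves universality of q at the second input. *)
Lemma universal_out_in2 e a b p : unital X -> tensor_left_universal e ->
  is_2cell p [:: e; a] [:: b] -> universal_out 1 p -> universal_in 2 p.
Proof.
move=> unitX [_ eL] pP pU; have [aE bE _] := binary_boundary pP.
have [v [q [_ qP qO qI]]] := eL _ a (conj aE erefl).
have [//|f fP pE] := universal_out_factor (Γ1 := [::]) (Γ2 := [::]) qP qO _ pP.
have fO : universal_out 1 f.
  by apply/(universal_out_comp (A1 := [::]) (A2 := [::]) qP fP qO); rewrite -pE.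
have /(universal_in_unaryP fP) fI :=
  invertible_universal_in fP (universal_out_invertible unitX fP fO).
apply/(universal_in2P pP) => D Γ Γ0.
apply: bij_comp ((universal_in2P qP).1 qI D Γ Γ0)
  (fI [::] D (e :: Γ) _) _ => // r rP.
rewrite pE; apply: (cut_assoc_ctx (D1 := [::]) (A1 := [:: e]) (A2 := [::])
  (B1 := [::]) (B2 := [::]) (C1 := [::]) (C2 := [::]) rP qP fP);
  by [exact: one_empty_nill | exact: one_empty_nilr].
Qed.

(** Here the comparison is made at the input: p is the cut of an invertible
    f : (a) -> (u) with the chosen universal q : (e,u) -> (b). *)
Lemma universal_in2_out e a b p : unital X -> tensor_left_universal e ->
  is_2cell p [:: e; a] [:: b] -> universal_in 2 p -> universal_out 1 p.
Proof.
move=> unitX [eL _] pP pU; have [aE bE _] := binary_boundary pP.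
have [u [q [_ qP qO qI]]] := eL _ b (conj bE erefl).
have [//|f fP pE] := bij_surj ((universal_in2P qP).1 qI [::] [:: a] _) pP.
have fO : universal_out 1 f.
  apply/(invertible_universal_out fP)/(invertible_of_bij_postcomp unitX fP).
  move=> Γ Γ0.
  apply: bij_cancel_post ((universal_in2P qP).1 qI [::] Γ Γ0)
    ((universal_in2P pP).1 pU [::] Γ Γ0) _ => r rP.
    exact: (cut_2cell_unary (D1 := [::])) rP fP.
  rewrite pE; apply: (cut_assoc_ctx (D1 := [::]) (A1 := [::]) (A2 := [::])
    (B1 := [::]) (B2 := [::]) (C1 := [:: e]) (C2 := [::]) rP fP qP);
    by [exact: one_empty_nill | exact: one_empty_nilr].
rewrite pE.
by apply/(universal_out_comp (A1 := [:: e]) (A2 := [::]) fP qP fO).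
Qed.

(** In contexts that contain those of r, t behaves as if it were universal. *)
Lemma universal_out_precomp_bij t r Θ a A1 A2 b : is_2cell t Θ [:: a] ->
  is_2cell r (A1 ++ a :: A2) [:: b] -> universal_out 1 r ->
  universal_out 1 (cut 1 (size A1).+1 t r) ->
  forall Γ1 Γ2 Δ, Δ <> [::] ->
    bij_between (hom (Γ1 ++ (A1 ++ a :: A2) ++ Γ2) Δ)
      (hom (Γ1 ++ (A1 ++ Θ ++ A2) ++ Γ2) Δ) (cut 1 (size (Γ1 ++ A1)).+1 t).
Proof.
move=> tP rP rU trU Γ1 Γ2 Δ Δ0; have trP := comp_2cell tP rP.
apply: bij_cancel_pre ((universal_out1P rP).1 rU Γ1 Γ2 Δ Δ0)
  ((universal_out1P trP).1 trU Γ1 Γ2 Δ Δ0) _ => k kP.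
by rewrite (comp_assoc tP rP kP).
Qed.


Lemma parallel_src s a Γ b Δ : is_2cell s (a :: Γ) (b :: Δ) -> src a = src b.
Proof.
move=> [sI sO]; have [x [y []]] := inp_out_parallel s.
by rewrite sI sO => -[-> _] [-> _].
Qed.

Lemma inp_consecutive s Γ1 a b Γ2 Δ :
  is_2cell s (Γ1 ++ a :: b :: Γ2) Δ -> tgt a = src b.
Proof.
move=> [sI _]; have [x [y [+ _]]] := inp_out_parallel s; rewrite sI.
by elim: Γ1 x {sI} => [|c Γ1 IH] x /= [_]; [case=> -> | apply: IH].
Qed.

(** By [universal_out_precomp_bij], cutting with t is bijective as soon as e
    stands before the inputs of t. For other contexts, e is introduced by a
    bijection that commutes with cutting with t. If a 1-cell g precedes the
    inputs of t, it is replaced by (u,e), where (u,e) -> (g) is universal; this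
    uses right universality of e. If none does, e is prepended to all the
    inputs, at the price of replacing the first output d by v, where
    (e,d) -> (v) is universal; this uses left universality. *)
Lemma universal_out_cancel e a b t r Θ : tensor_universal e ->
  is_2cell t Θ [:: a] -> is_2cell r [:: e; a] [:: b] ->
  universal_out 1 r -> universal_out 1 (cut 1 2 t r) -> universal_out 1 t.
Proof.
move=> [[_ eL] [eR _]] tP rP rU trU.
have ctx := universal_out_precomp_bij (A1 := [:: e]) (A2 := [::]) tP rP rU trU.
have [aE _ _] := binary_boundary rP.
have [c [Θ' ΘE]] : exists c Θ', Θ = c :: Θ'.
  case: (Θ) tP => [[tI _]|c Θ' _]; last by exists c, Θ'.
  by case: (inp_neq0 tI).
have cE : src c = tgt e by rewrite -aE; move: tP; rewrite ΘE => /parallel_src.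
apply/(universal_out1P tP) => Γ1 Γ2 Δ Δ0.
apply: bij_between_of_inhabited => [k kP|[s]]; first exact: comp_2cell tP kP.
case/lastP: Γ1 => [|Γ1 g] sP.
  case: Δ => [//|d Δ] in Δ0 sP *.
  have dE : src d = tgt e.
    by rewrite -cE; move: sP; rewrite ΘE => /parallel_src.
  have [v [m [_ mP _ /(universal_in2P mP)mI]]] := eL _ d (conj dE erefl).
  (* No 1-cell precedes the inputs of t: transport along m : (e,d) -> (v). *)
  apply: (bij_cancel_post (g := fun k => cut 1 2 k m)
    (h := fun k => cut 1 2 t (cut 1 2 k m))) => [k kP||| k kP].
  - exact: (comp_2cell (A1 := [::])) tP kP.
  - by apply: mI; rewrite ΘE.
  - apply: bij_comp (mI Δ (a :: Γ2) _) _ (fun _ _ => erefl) => //.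
    by have := ctx [::] Γ2 (v :: Δ); rewrite /= cats0; apply.
  by apply: (cut_assoc_ctx (D1 := [::]) (A1 := [::]) (B1 := [::])
     (C1 := [:: e]) (C2 := [::]) (D2 := [::]) tP kP mP);
    by [exact: one_empty_nill | exact: one_empty_nilr].
rewrite -cats1 -!catA /= in sP *.
have gE : tgt g = tgt e.
  by rewrite -cE; move: sP; rewrite ΘE => /inp_consecutive.
have [u [n [_ nP /(universal_out1P nP)nO _]]] := eR _ g (conj erefl gE).
(* The 1-cell g precedes the inputs of t: transport along n : (u,e) -> (g). *)
apply: (bij_cancel_post (g := cut 1 (size Γ1).+1 n)
    (h := fun k => cut 1 (size (Γ1 ++ [:: u; e])).+1 t
                     (cut 1 (size Γ1).+1 n k))) => [k kP||| k kP].
- have := comp_2cell (A1 := Γ1 ++ [:: g]) (A2 := Γ2) (q := k) (Δ := Δ) tP.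
    by rewrite -!catA; apply.
- exact: nO.
- apply: bij_comp (nO Γ1 (a :: Γ2) Δ Δ0) _ (fun _ _ => erefl).
  have := ctx (Γ1 ++ [:: u]) Γ2 Δ Δ0.
  by rewrite -!catA.
rewrite size_cat /= -[size Γ1 + 2]addn0 size_cat.
by apply: (cut_interchange_ctx (D1 := [::]) (D2 := [::]) (A2 := [::])
   nP tP kP); exact: one_empty_nilr.
Qed.


(** * Composing and cancelling tensor universal 1-cells *)

Lemma in2_interchange p q r e e' e'' w b Γ D :
  is_2cell p [:: e; e'] [:: e''] -> is_2cell q [:: e''; w] [:: b] ->
  is_2cell r Γ (w :: D) ->
  cut 1 3 r (cut 1 1 p q) = cut 1 1 p (cut 1 2 r q).
Proof.
move=> pP qP rP.
by apply: (cut_interchange_ctx (A1 := [::]) (A2 := [::]) (A3 := [::])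
  (D1 := [::]) pP rP qP); exact: one_empty_nill.
Qed.

Lemma in2_assoc r t s e e' a w b Γ D :
  is_2cell r Γ (w :: D) -> is_2cell t [:: e'; w] [:: a] ->
  is_2cell s [:: e; a] [:: b] ->
  cut 1 3 r (cut 1 2 t s) = cut 1 2 (cut 1 2 r t) s.
Proof.
move=> rP tP sP.
by apply: (cut_assoc_ctx (D1 := [::]) (A1 := [:: e']) (A2 := [::])
  (B1 := [::]) (B2 := [::]) (C1 := [:: e]) (C2 := [::]) rP tP sP);
  by [exact: one_empty_nill | exact: one_empty_nilr].
Qed.

(** The 2-cell q is the factor through p of the cut of t with s. Its universal
    properties are those of this cut, because p is universal. *)
Lemma left_biuniversal_comp p s t e e' e'' u w a :
  is_2cell p [:: e; e'] [:: e''] -> universal_out 1 p ->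
  is_2cell s [:: e; u] [:: a] -> universal_out 1 s -> universal_in 2 s ->
  is_2cell t [:: e'; w] [:: u] -> universal_out 1 t -> universal_in 2 t ->
  exists q, [/\ is_2cell q [:: e''; w] [:: a],
                universal_out 1 q & universal_in 2 q].
Proof.
move=> pP pU sP sO sI tP tO tI.
have cP := comp_2cell (A1 := [:: e]) (A2 := [::]) tP sP.
have [//|q qP cE] :=
  universal_out_factor (Γ1 := [::]) (Γ2 := [:: w]) pP pU _ cP.
exists q; split=> //.
  apply/(universal_out_comp (A1 := [::]) (A2 := [:: w]) pP qP pU).
  rewrite -cE.
  by apply/(universal_out_comp (A1 := [:: e]) (A2 := [::]) tP sP tO).
apply/(universal_in2P qP) => D Γ Γ0.
apply: (bij_cancel_post (g := cut 1 1 p)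
  (h := fun r => cut 1 3 r (cut 1 2 t s)))
  => [r rP||| r rP].
- have := cut_2cell (D1 := [::]) (C1 := [:: e'']) (C2 := [::]) rP qP.
  by rewrite /= cats0; apply; [exact: one_empty_nilr | exact: one_empty_nill].
- by apply: ((universal_out1P pP).1 pU [::] Γ (a :: D)).
- apply: bij_comp ((universal_in2P tP).1 tI D Γ Γ0)
    ((universal_in2P sP).1 sI D (e' :: Γ) _) _ => // r rP.
  exact: in2_assoc rP tP sP.
by rewrite cE (in2_interchange pP qP rP).
Qed.

(** The 2-cell t is the factor through r of the cut of p with q. At its second
    input everything happens after e, and bijections cancel directly; at its
    output this is [universal_out_cancel]. *)
Lemma left_biuniversal_cancel p q r e e' e'' w a b : tensor_universal e ->
  is_2cell p [:: e; e'] [:: e''] -> universal_out 1 p ->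
  is_2cell q [:: e''; w] [:: b] -> universal_out 1 q -> universal_in 2 q ->
  is_2cell r [:: e; a] [:: b] -> universal_out 1 r -> universal_in 2 r ->
  exists t, [/\ is_2cell t [:: e'; w] [:: a],
                universal_out 1 t & universal_in 2 t].
Proof.
move=> eT pP pO qP qO qI rP rO rI.
have cP := comp_2cell (A1 := [::]) (A2 := [:: w]) pP qP.
have [//|t tP cE] := bij_surj ((universal_in2P rP).1 rI [::] [:: e'; w] _) cP.
exists t; split=> //.
  apply: (universal_out_cancel eT tP rP rO); rewrite -cE.
  by apply/(universal_out_comp (A1 := [::]) (A2 := [:: w]) pP qP pO).
apply/(universal_in2P tP) => D Γ Γ0.
apply: (bij_cancel_post (g := fun k => cut 1 2 k r)
  (h := fun k => cut 1 3 k (cut 1 2 t r))) => [k kP||| k kP].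
- have := cut_2cell (D1 := [::]) (C1 := [:: e']) (C2 := [::]) kP tP.
  by rewrite /= cats0; apply; [exact: one_empty_nilr | exact: one_empty_nill].
- by apply: ((universal_in2P rP).1 rI D (e' :: Γ)).
- apply: bij_comp ((universal_in2P qP).1 qI D Γ Γ0)
    ((universal_out1P pP).1 pO [::] Γ (b :: D) _) _ => // k kP.
  by rewrite -cE (in2_interchange pP qP kP).
exact: in2_assoc kP tP rP.
Qed.

(** The 2-cell t is the factor through n of the cut of p with q. For
    universality at the first input, let s end in (g,e'). Dividing g by e on
    the right, that is, replacing it by (h,e), makes p applicable to (e,e');
    q then turns e'' into w, and n turns (h,e) over w into u. *)
Lemma right_biuniversal_cancel p q n e e' e'' w u b :
  tensor_right_universal e ->
  is_2cell p [:: e; e'] [:: e''] -> universal_out 1 p ->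
  is_2cell q [:: w; e''] [:: b] -> universal_out 1 q -> universal_in 1 q ->
  is_2cell n [:: w; e] [:: u] -> universal_out 1 n -> universal_in 1 n ->
  exists t, [/\ is_2cell t [:: u; e'] [:: b],
                universal_out 1 t & universal_in 1 t].
Proof.
move=> [eR _] pP pO qP qO qI nP nO nI; have [e'E _ _] := binary_boundary pP.
have cP := comp_2cell (A1 := [:: w]) (A2 := [::]) pP qP.
have [//|t tP cE] :=
  universal_out_factor (Γ1 := [::]) (Γ2 := [:: e']) nP nO _ cP.
exists t; split=> //.
  apply/(universal_out_comp (A1 := [::]) (A2 := [:: e']) nP tP nO); rewrite -cE.
  by apply/(universal_out_comp (A1 := [:: w]) (A2 := [::]) pP qP pO).
apply/(universal_in1P tP) => D Γ Γ0.
have typed Γ' k : is_2cell k Γ' (D ++ [:: u]) ->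
    is_2cell (cut (size D).+1 1 k t) (Γ' ++ [:: e']) (D ++ [:: b]).
  move=> kP; have := cut_2cell (C1 := [::]) kP tP.
  by apply; [exact: one_empty_nill | exact: one_empty_nilr].
apply: bij_between_of_inhabited => [k|[s]]; first exact: typed.
case/lastP: Γ => [//|Γ g] in Γ0 *; rewrite -cats1 -catA => sP.
have gE : tgt g = tgt e by rewrite -e'E; exact: inp_consecutive sP.
have [h [m [_ mP mO _]]] := eR _ g (conj erefl gE).
have mB := (universal_out1P mP).1 mO Γ.
(* The case of inputs ending in (h,e): both n and q, p compute these homs from
   the 2-cells with inputs (Γ,h) and last output w. *)
have ne x (A : seq (cell1 X)) : A ++ [:: x] <> [::] by case: A.
have tB : bij_between (hom (Γ ++ [:: h; e]) (D ++ [:: u]))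
    (hom (Γ ++ [:: h; e; e']) (D ++ [:: b])) (fun k => cut (size D).+1 1 k t).
  have := (universal_in1P nP).1 nI D (Γ ++ [:: h]) (@ne _ _).
  have := (universal_in1P qP).1 qI D (Γ ++ [:: h]) (@ne _ _).
  have := (universal_out1P pP).1 pO (Γ ++ [:: h]) [::] (D ++ [:: b]) (@ne _ _).
  rewrite -!catA /= => pB qB nB.
  apply: bij_cancel_pre nB (bij_comp qB pB (fun _ _ => erefl)) _ => k kP /=.
  transitivity (cut (size D).+1 1 k (cut 1 2 p q)).
    have := cut_interchange_ctx (A1 := [::]) (A2 := [::]) (A3 := [::])
      (D2 := [::]) kP pP qP (one_empty_nill _) (one_empty_nill _).
    by rewrite /= add0n addn0.
  rewrite cE -{2}[size D]addn0.
  by apply: (cut_assoc_ctx (A1 := [::]) (A2 := [:: e]) (B1 := [::])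
    (B2 := [::]) (C1 := [::]) (C2 := [:: e']) (D2 := [::]) kP nP tP);
    by [exact: one_empty_nill | exact: one_empty_nilr].
have := mB [:: e'] (D ++ [:: b]) (@ne _ _).
have := mB [::] (D ++ [:: u]) (@ne _ _).
move=> mB1 mB2.
apply: bij_cancel_post mB2 (bij_comp mB1 tB (fun _ _ => erefl)) _ => k kP /=.
  by have := typed _ _ kP; rewrite -catA.
by apply/esym/(cut_assoc_ctx (D1 := [::]) (D2 := [::]) (A2 := [::])
  (B2 := [::]) (C1 := [::]) (C2 := [:: e']) mP kP tP);
  by [exact: one_empty_nill | exact: one_empty_nilr].
Qed.

Lemma tensor_left_universal_comp p e e' e'' :
  is_2cell p [:: e; e'] [:: e''] -> universal_out 1 p ->
  tensor_left_universal e -> tensor_left_universal e' ->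
  tensor_left_universal e''.
Proof.
move=> pP pO [eD eL] [e'D e'L]; have [e'E sE tE] := binary_boundary pP.
split=> y a; rewrite ?sE ?tE => aC.
  have [u [s [uC sP sO sI]]] := eD _ _ aC; rewrite -e'E in uC.
  have [w [t [wC tP tO tI]]] := e'D _ _ uC.
  have [q [qP qO qI]] := left_biuniversal_comp pP pO sP sO sI tP tO tI.
  by exists w, q.
have [u [t [uC tP tO tI]]] := e'L _ _ aC; rewrite e'E in uC.
have [v [s [vC sP sO sI]]] := eL _ _ uC.
have [q [qP qO qI]] := left_biuniversal_comp pP pO sP sO sI tP tO tI.
by exists v, q.
Qed.

Lemma tensor_left_universal_cancel p e e' e'' :
  is_2cell p [:: e; e'] [:: e''] -> universal_out 1 p ->
  tensor_universal e -> tensor_left_universal e'' -> tensor_left_universal e'.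
Proof.
move=> pP pO eT [e''D e''L]; have [e'E sE tE] := binary_boundary pP.
have [[eD eL] _] := eT; rewrite sE tE in e''D e''L; split=> y a.
  rewrite e'E => aC; have [v [r [vC rP rO rI]]] := eL _ _ aC.
  have [w [q [wC qP qO qI]]] := e''D _ _ vC.
  have [t [tP tO tI]] := left_biuniversal_cancel eT pP pO qP qO qI rP rO rI.
  by exists w, t.
move=> aC; have [v [q [vC qP qO qI]]] := e''L _ _ aC.
have [u [r [uC rP rO rI]]] := eD _ _ vC; rewrite -e'E in uC.
have [t [tP tO tI]] := left_biuniversal_cancel eT pP pO qP qO qI rP rO rI.
by exists u, t.
Qed.

Lemma tensor_right_universal_cancel p e e' e'' :
  is_2cell p [:: e; e'] [:: e''] -> universal_out 1 p ->
  tensor_right_universal e -> tensor_right_universal e'' ->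
  tensor_right_universal e'.
Proof.
move=> pP pO eT [e''D e''R]; have [e'E sE tE] := binary_boundary pP.
have [eD eR] := eT; rewrite sE tE in e''D e''R; split=> z b.
  move=> bC; have [w [q [wC qP qO qI]]] := e''D _ _ bC.
  have [u [n [uC nP nO nI]]] := eR _ _ wC; rewrite -e'E in uC.
  have [t [tP tO tI]] := right_biuniversal_cancel eT pP pO qP qO qI nP nO nI.
  by exists u, t.
rewrite e'E => bC; have [w [n [wC nP nO nI]]] := eD _ _ bC.
have [v [q [vC qP qO qI]]] := e''R _ _ wC.
have [t [tP tO tI]] := right_biuniversal_cancel eT pP pO qP qO qI nP nO nI.
by exists v, t.
Qed.

End Cuts.
(** * Reversing all sequences *)

Section Mirror.
Variable X : polyBicategory.
Implicit Types (a b e : cell1 X) (t s r p : cell2 X).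
Implicit Types (Γ Δ : seq (cell1 X)).

Lemma rev_neq0 Γ : Γ <> [::] -> rev Γ <> [::].
Proof. by move=> Γ0 /(f_equal rev); rewrite revK. Qed.

Lemma composable_rcons x y Γ a :
  composable (@src X) (@tgt X) x (rcons Γ a) y <->
  composable (@src X) (@tgt X) x Γ (src a) /\ tgt a = y.
Proof.
elim: Γ x => [|c Γ IH] x /=; first by split=> [] [-> ->].
by rewrite IH; split=> [[-> [? ?]]|[[-> ?] ?]].
Qed.

Lemma composable_rev x y Γ :
  composable (@src X) (@tgt X) x Γ y ->
  composable (@tgt X) (@src X) y (rev Γ) x.
Proof.
elim/last_ind: Γ y => [|Γ a IH] y; first by move=> /= ->.
by rewrite composable_rcons rev_rcons => -[/IH ? ?].
Qed.

(** Reversing a composable sequence exchanges sources and targets of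
    1-cells, while inputs and outputs of 2-cells keep their roles. *)
Definition mirror_polygraph : polygraph.
Proof.
refine (@Polygraph (cell0 X) (cell1 X) (cell2 X) (@tgt X) (@src X)
  (fun p => rev (inp p)) (fun p => rev (out p)) _ _ _).
- by move=> p; apply/rev_neq0/inp_neq0.
- by move=> p; apply/rev_neq0/out_neq0.
move=> p; have [x [y [pI pO]]] := inp_out_parallel p.
by exists y, x; split; apply: composable_rev.
Defined.

(** Positions are counted from the other end. *)
Definition mirror_cut j i t s :=
  cut ((size (out t)).+1 - j) ((size (inp s)).+1 - i) t s.

Lemma splits_rev Γ j Δ1 a Δ2 :
  splits (X := mirror_polygraph) (rev Γ) j Δ1 a Δ2 ->
  splits (X := X) Γ ((size Γ).+1 - j) (rev Δ2) a (rev Δ1).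
Proof.
move=> [ΓE ->]; have {}ΓE : Γ = rev Δ2 ++ a :: rev Δ1.
  by rewrite -[Γ]revK ΓE rev_cat rev_cons -cats1 -catA.
split=> //; rewrite ΓE size_cat /= !size_rev; lia.
Qed.

Lemma one_empty_rev (Γ Δ : seq (cell1 X)) :
  one_empty Γ Δ -> one_empty (rev Γ) (rev Δ).
Proof. by case=> ->; [left | right]. Qed.

Lemma mirror_cuttable j i t s :
  cuttable (X := mirror_polygraph) j i t s ->
  [/\ cuttable (X := X) ((size (out t)).+1 - j) ((size (inp s)).+1 - i) t s,
      0 < j <= size (out t) & 0 < i <= size (inp s)].
Proof.
move=> [Δ1 [Δ2 [Γ1 [Γ2 [a [tE sE o1 o2]]]]]].
have [tE' sE'] := (splits_rev tE, splits_rev sE).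
split.
- exists (rev Δ2), (rev Δ1), (rev Γ2), (rev Γ1), a.
  by split=> //; apply: one_empty_rev.
- by case: tE => /(f_equal size); rewrite size_rev size_cat /= => -> ->; lia.
by case: sE => /(f_equal size); rewrite size_rev size_cat /= => -> ->; lia.
Qed.

Lemma cut_size j i t s : cuttable (X := X) j i t s ->
  (size (inp (cut j i t s))).+1 = size (inp t) + size (inp s) /\
  (size (out (cut j i t s))).+1 = size (out t) + size (out s).
Proof.
move=> [Δ1 [Δ2 [Γ1 [Γ2 [a [tE sE o1 o2]]]]]].
have [-> ->] := cut_boundary tE sE o1 o2.
case: tE sE => [-> _] [-> _]; rewrite !size_cat /=; lia.
Qed.

Lemma mirror_cut_size j i t s : cuttable (X := mirror_polygraph) j i t s ->
  (size (inp (mirror_cut j i t s))).+1 = size (inp t) + size (inp s) /\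
  (size (out (mirror_cut j i t s))).+1 = size (out t) + size (out s).
Proof. by move=> /mirror_cuttable[/cut_size]. Qed.

Local Notation mcuttable := (cuttable (X := mirror_polygraph)).

(** The three laws for composites of three 2-cells hold by those of X at the
    reversed positions; the interchange laws are used from right to left, as the order
    of the two positions is exchanged. *)
Lemma mirror_cut_assoc j i k l t s r :
  mcuttable j i t s -> mcuttable (j + k).-1 l (mirror_cut j i t s) r ->
  mcuttable k l s r -> mcuttable j (l + i).-1 t (mirror_cut k l s r) ->
  mirror_cut j (l + i).-1 t (mirror_cut k l s r) =
  mirror_cut (j + k).-1 l (mirror_cut j i t s) r.
Proof.
move=> ts tsr sr tsr'.
have [[Its Ots] [Isr Osr]] := (mirror_cut_size ts, mirror_cut_size sr).
have [ts' jB iB] := mirror_cuttable ts; have [sr' kB lB] := mirror_cuttable sr.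
have [tsr'' _ _] := mirror_cuttable tsr.
have [tsr''' _ _] := mirror_cuttable tsr'.
rewrite [LHS]/mirror_cut [RHS]/mirror_cut.
have E1 : (size (inp (mirror_cut k l s r))).+1 - (l + i).-1 =
  ((size (inp r)).+1 - l + ((size (inp s)).+1 - i)).-1 by lia.
have E2 : (size (out (mirror_cut j i t s))).+1 - (j + k).-1 =
  ((size (out t)).+1 - j + ((size (out s)).+1 - k)).-1 by lia.
rewrite E1 E2 in tsr'' tsr''' *.
exact: cut_assoc.
Qed.

Lemma mirror_cut_interchange_out j i k l t s r : j < k ->
  mcuttable j i t s ->
  mcuttable (k + size (out s)).-1 l (mirror_cut j i t s) r ->
  mcuttable k l t r -> mcuttable j i (mirror_cut k l t r) s ->
  mirror_cut (k + size (out s)).-1 l (mirror_cut j i t s) r =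
  mirror_cut j i (mirror_cut k l t r) s.
Proof.
move=> jk ts tsr tr trs.
have [[Its Ots] [Itr Otr]] := (mirror_cut_size ts, mirror_cut_size tr).
have [ts' jB iB] := mirror_cuttable ts; have [tr' kB lB] := mirror_cuttable tr.
have [tsr' _ _] := mirror_cuttable tsr.
have [trs' _ _] := mirror_cuttable trs.
rewrite [LHS]/mirror_cut [RHS]/mirror_cut.
have E1 : (size (out (mirror_cut j i t s))).+1 - (k + size (out s)).-1 =
  (size (out t)).+1 - k by lia.
have E2 : (size (out (mirror_cut k l t r))).+1 - j =
  ((size (out t)).+1 - j + size (out r)).-1 by lia.
rewrite E1 E2 in tsr' trs' *.
by apply/esym/cut_interchange_out => //; lia.
Qed.

Lemma mirror_cut_interchange_in j i k l t s r : i < l ->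
  mcuttable j i t r ->
  mcuttable k (l + size (inp t)).-1 s (mirror_cut j i t r) ->
  mcuttable k l s r -> mcuttable j i t (mirror_cut k l s r) ->
  mirror_cut k (l + size (inp t)).-1 s (mirror_cut j i t r) =
  mirror_cut j i t (mirror_cut k l s r).
Proof.
move=> il tr str sr tsr.
have [[Itr Otr] [Isr Osr]] := (mirror_cut_size tr, mirror_cut_size sr).
have [tr' jB iB] := mirror_cuttable tr; have [sr' kB lB] := mirror_cuttable sr.
have [str' _ _] := mirror_cuttable str.
have [tsr' _ _] := mirror_cuttable tsr.
rewrite [LHS]/mirror_cut [RHS]/mirror_cut.
have E1 : (size (inp (mirror_cut j i t r))).+1 - (l + size (inp t)).-1 =
  (size (inp r)).+1 - l by lia.
have E2 : (size (inp (mirror_cut k l s r))).+1 - i =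
  ((size (inp r)).+1 - i + size (inp s)).-1 by lia.
rewrite E1 E2 in str' tsr' *.
by apply/esym/cut_interchange_in => //; lia.
Qed.

Definition mirror : polyBicategory.
Proof.
refine (@PolyBicategory mirror_polygraph mirror_cut _ mirror_cut_assoc _ _).
- move=> j i t s Δ1 Δ2 Γ1 Γ2 a /splits_rev tE /splits_rev sE o1 o2.
  have [Ic Oc] := cut_boundary tE sE (one_empty_rev o2) (one_empty_rev o1).
  split; rewrite /= /mirror_cut.
    by rewrite Ic !rev_cat !revK catA.
  by rewrite Oc !rev_cat !revK catA.
- move=> j i k l t s r; rewrite [size (out s)]size_rev.
  exact: mirror_cut_interchange_out.
move=> j i k l t s r; rewrite [size (inp t)]size_rev.
exact: mirror_cut_interchange_in.
Defined.

(** The transfer lemmas are equivalences between X and its mirror, so that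
    none of them has to be applied to the mirror of the mirror, which is not
    convertible to X. *)
Lemma mirror_2cell t Γ Δ :
  is_2cell (X := mirror) t Γ Δ <-> is_2cell (X := X) t (rev Γ) (rev Δ).
Proof.
split=> -[tI tO]; split.
- by rewrite -tI revK.
- by rewrite -tO revK.
- by rewrite /= tI revK.
by rewrite /= tO revK.
Qed.

Lemma mirror_cutE t s Θ D1 a D2 C1 C2 Δ :
  is_2cell (X := X) t Θ (D1 ++ a :: D2) ->
  is_2cell (X := X) s (C1 ++ a :: C2) Δ ->
  cut (p := mirror) (size D2).+1 (size C2).+1 t s =
  cut (p := X) (size D1).+1 (size C1).+1 t s.
Proof.
move=> [_ tE] [sE _]; rewrite /= /mirror_cut tE sE !size_cat /=.
by congr cut; lia.
Qed.

Lemma mirror_unital : unital X -> unital mirror.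
Proof.
move=> unitX a; have [u [uC uL uR]] := unitX a; exists u; split.
- exact/mirror_2cell.
- by move=> j i s /mirror_cuttable[/uL].
by move=> j i s /mirror_cuttable[/uR].
Qed.

Lemma mirror_universal_out1 t Θ a : is_2cell (X := X) t Θ [:: a] ->
  universal_out (X := mirror) 1 t <-> universal_out (X := X) 1 t.
Proof.
move=> tP.
have tP' : is_2cell (X := mirror) t (rev Θ) [:: a].
  by apply/mirror_2cell; rewrite revK.
rewrite (universal_out1P tP) (universal_out1P tP').
have key Γ1 Γ2 Δ :
  bij_between (fun r => is_2cell (X := mirror) r (Γ1 ++ a :: Γ2) Δ)
    (fun r => is_2cell (X := mirror) r (Γ1 ++ rev Θ ++ Γ2) Δ)
    (cut (p := mirror) 1 (size Γ1).+1 t) <->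
  bij_between (fun r => is_2cell (X := X) r (rev Γ2 ++ a :: rev Γ1) (rev Δ))
    (fun r => is_2cell (X := X) r (rev Γ2 ++ Θ ++ rev Γ1) (rev Δ))
    (cut (p := X) 1 (size (rev Γ2)).+1 t).
  have homE r : is_2cell (X := mirror) r (Γ1 ++ a :: Γ2) Δ <->
      is_2cell (X := X) r (rev Γ2 ++ a :: rev Γ1) (rev Δ).
    by rewrite mirror_2cell rev_cat rev_cons -cats1 -catA.
  apply: bij_between_ext => [//|r|r /homE rP].
    by rewrite mirror_2cell !rev_cat revK -catA.
  by rewrite -(mirror_cutE (D1 := [::]) (D2 := [::]) tP rP) size_rev.
split=> U Γ1 Γ2 Δ Δ0.
  have /key := U (rev Γ2) (rev Γ1) (rev Δ) (rev_neq0 Δ0).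
  by rewrite !revK.
by apply/key/U/rev_neq0.
Qed.

Lemma mirror_universal_in t A1 a A2 Δ : is_2cell (X := X) t (A1 ++ a :: A2) Δ ->
  universal_in (X := mirror) (size A2).+1 t <->
  universal_in (X := X) (size A1).+1 t.
Proof.
move=> tP.
have tP' : is_2cell (X := mirror) t (rev A2 ++ a :: rev A1) (rev Δ).
  by apply/mirror_2cell; rewrite revK rev_cat rev_cons -cats1 !revK -catA.
rewrite (universal_inP tP) -(size_rev A2) (universal_inP tP').
have key D1 D2 Γ :
  bij_between (fun r => is_2cell (X := mirror) r Γ (D1 ++ a :: D2))
    (fun r => is_2cell (X := mirror) r (rev A2 ++ Γ ++ rev A1)
       (D1 ++ rev Δ ++ D2))
    (fun r => cut (p := mirror) (size D1).+1 (size (rev A2)).+1 r t) <->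
  bij_between (fun r => is_2cell (X := X) r (rev Γ) (rev D2 ++ a :: rev D1))
    (fun r => is_2cell (X := X) r (A1 ++ rev Γ ++ A2) (rev D2 ++ Δ ++ rev D1))
    (fun r => cut (p := X) (size (rev D2)).+1 (size A1).+1 r t).
  have homE r : is_2cell (X := mirror) r Γ (D1 ++ a :: D2) <->
      is_2cell (X := X) r (rev Γ) (rev D2 ++ a :: rev D1).
    by rewrite mirror_2cell rev_cat rev_cons -cats1 -catA.
  apply: bij_between_ext => [//|r|r /homE rP].
    by rewrite mirror_2cell !rev_cat !revK -!catA.
  by rewrite -(mirror_cutE rP tP) !size_rev.
split=> U D1 D2 Γ Γ0 o1 o2.
  have /key := U (rev D2) (rev D1) (rev Γ) (rev_neq0 Γ0)
    (one_empty_rev o2) (one_empty_rev o1).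
  by rewrite !revK.
apply/key/U; first exact: rev_neq0.
  by rewrite -[A1]revK; apply: one_empty_rev.
by rewrite -[A2]revK; apply: one_empty_rev.
Qed.

Lemma mirror_binary p a b c :
  is_2cell (X := X) p [:: a; b] [:: c] <->
  is_2cell (X := mirror) p [:: b; a] [:: c].
Proof. by apply: iff_sym; apply: mirror_2cell. Qed.

Lemma mirror_universal_in1 p a b c : is_2cell (X := X) p [:: a; b] [:: c] ->
  universal_in (X := X) 1 p <-> universal_in (X := mirror) 2 p.
Proof.
move=> pP.
exact: iff_sym (mirror_universal_in (A1 := [::]) (A2 := [:: b]) pP).
Qed.

Lemma mirror_universal_in2 p a b c : is_2cell (X := X) p [:: a; b] [:: c] ->
  universal_in (X := X) 2 p <-> universal_in (X := mirror) 1 p.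
Proof.
move=> pP.
exact: iff_sym (mirror_universal_in (A1 := [:: a]) (A2 := [::]) pP).
Qed.

Lemma mirror_1cell a x y :
  is_1cell (X := X) a x y <-> is_1cell (X := mirror) a y x.
Proof. by split=> -[]. Qed.

Lemma mirror_left_biuniversal p a b c :
  [/\ is_2cell (X := X) p [:: a; b] [:: c], universal_out (X := X) 1 p
    & universal_in (X := X) 2 p] <->
  [/\ is_2cell (X := mirror) p [:: b; a] [:: c], universal_out (X := mirror) 1 p
    & universal_in (X := mirror) 1 p].
Proof.
split=> -[pP pO pI].
  split; [exact/mirror_binary | exact/(mirror_universal_out1 pP)|].
  exact/(mirror_universal_in2 pP).
move/mirror_binary in pP; split=> //; first exact/(mirror_universal_out1 pP).
exact/(mirror_universal_in2 pP).
Qed.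

Lemma mirror_right_biuniversal p a b c :
  [/\ is_2cell (X := X) p [:: a; b] [:: c], universal_out (X := X) 1 p
    & universal_in (X := X) 1 p] <->
  [/\ is_2cell (X := mirror) p [:: b; a] [:: c], universal_out (X := mirror) 1 p
    & universal_in (X := mirror) 2 p].
Proof.
split=> -[pP pO pI].
  split; [exact/mirror_binary | exact/(mirror_universal_out1 pP)|].
  exact/(mirror_universal_in1 pP).
move/mirror_binary in pP; split=> //; first exact/(mirror_universal_out1 pP).
exact/(mirror_universal_in1 pP).
Qed.

Lemma mirror_tensor_left e :
  tensor_left_universal (X := X) e <-> tensor_right_universal (X := mirror) e.
Proof.
split=> -[eD eL]; split=> y a /mirror_1cell aC.
- have [u [p [/mirror_1cell uC pP pO pI]]] := eD _ _ aC; exists u, p.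
  by have [] := (mirror_left_biuniversal p e u a).1 (And3 pP pO pI).
- have [v [p [/mirror_1cell vC pP pO pI]]] := eL _ _ aC; exists v, p.
  by have [] := (mirror_left_biuniversal p e a v).1 (And3 pP pO pI).
- have [u [p [/mirror_1cell uC pP pO pI]]] := eD _ _ aC; exists u, p.
  by have [] := (mirror_left_biuniversal p e u a).2 (And3 pP pO pI).
have [v [p [/mirror_1cell vC pP pO pI]]] := eL _ _ aC; exists v, p.
by have [] := (mirror_left_biuniversal p e a v).2 (And3 pP pO pI).
Qed.

Lemma mirror_tensor_right e :
  tensor_right_universal (X := X) e <-> tensor_left_universal (X := mirror) e.
Proof.
split=> -[eD eL]; split=> y a /mirror_1cell aC.
- have [u [p [/mirror_1cell uC pP pO pI]]] := eD _ _ aC; exists u, p.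
  by have [] := (mirror_right_biuniversal p u e a).1 (And3 pP pO pI).
- have [v [p [/mirror_1cell vC pP pO pI]]] := eL _ _ aC; exists v, p.
  by have [] := (mirror_right_biuniversal p a e v).1 (And3 pP pO pI).
- have [u [p [/mirror_1cell uC pP pO pI]]] := eD _ _ aC; exists u, p.
  by have [] := (mirror_right_biuniversal p u e a).2 (And3 pP pO pI).
have [v [p [/mirror_1cell vC pP pO pI]]] := eL _ _ aC; exists v, p.
by have [] := (mirror_right_biuniversal p a e v).2 (And3 pP pO pI).
Qed.

Lemma mirror_tensor e :
  tensor_universal (X := X) e <-> tensor_universal (X := mirror) e.
Proof.
rewrite /tensor_universal mirror_tensor_left mirror_tensor_right.
by split=> -[].
Qed.

End Mirror.

(** * Two out of three *)

Lemma universal_in2_iff_out (X : polyBicategory) (e e' e'' : cell1 X) p :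
  unital X -> is_2cell p [:: e; e'] [:: e''] -> tensor_left_universal e ->
  universal_in 2 p <-> universal_out 1 p.
Proof.
move=> unitX pP eT; split; first exact: universal_in2_out unitX eT pP.
exact: universal_out_in2 unitX eT pP.
Qed.

Lemma universal_in1_iff_out (X : polyBicategory) (e e' e'' : cell1 X) p :
  unital X -> is_2cell p [:: e; e'] [:: e''] -> tensor_right_universal e' ->
  universal_in 1 p <-> universal_out 1 p.
Proof.
move=> unitX pP /mirror_tensor_right e'T.
rewrite (mirror_universal_in1 pP) -(mirror_universal_out1 pP).
move/mirror_binary in pP.
exact: universal_in2_iff_out (mirror_unital unitX) pP e'T.
Qed.

Lemma tensor_universal_comp (X : polyBicategory) (e e' e'' : cell1 X) p :
  is_2cell p [:: e; e'] [:: e''] -> universal_out 1 p ->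
  tensor_universal e -> tensor_universal e' -> tensor_universal e''.
Proof.
move=> pP pO [eL eR] [e'L e'R]; split.
  exact: tensor_left_universal_comp pP pO eL e'L.
move/(mirror_universal_out1 pP) in pO; move/mirror_binary in pP.
apply/mirror_tensor_right/(tensor_left_universal_comp pP pO);
  exact/mirror_tensor_right.
Qed.

Lemma tensor_universal_cancel_left
    (X : polyBicategory) (e e' e'' : cell1 X) p :
  is_2cell p [:: e; e'] [:: e''] -> universal_out 1 p ->
  tensor_universal e -> tensor_universal e'' -> tensor_universal e'.
Proof.
move=> pP pO eT [e''L e''R]; split.
  exact: tensor_left_universal_cancel pP pO eT e''L.
exact: tensor_right_universal_cancel pP pO eT.2 e''R.
Qed.

Lemma tensor_universal_cancel_right
    (X : polyBicategory) (e e' e'' : cell1 X) p :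
  is_2cell p [:: e; e'] [:: e''] -> universal_out 1 p ->
  tensor_universal e' -> tensor_universal e'' -> tensor_universal e.
Proof.
move=> pP pO /mirror_tensor e'T /mirror_tensor e''T; apply/mirror_tensor.
move/(mirror_universal_out1 pP) in pO; move/mirror_binary in pP.
exact: tensor_universal_cancel_left pP pO e'T e''T.
Qed.

Theorem theorem3p6 (X : polyBicategory) (x x' x'' : cell0 X)
    (e e' e'' : cell1 X) (p : cell2 X) :
  unital X ->
  is_1cell e x x' -> is_1cell e' x' x'' -> is_1cell e'' x x'' ->
  is_2cell p [:: e; e'] [:: e''] ->
  two_of_three (universal_out 1 p) (universal_in 1 p) (universal_in 2 p) ->
  two_of_three (tensor_universal e) (tensor_universal e')
    (tensor_universal e'') ->
  [/\ tensor_universal e, tensor_universal e', tensor_universal e''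
    & everywhere_universal p].
Proof.
move=> unitX _ _ _ pP pU eT.
(* If universality at the output is not among the two properties, p is
   universal at both inputs; and e or e' is tensor universal, which carries one
   of these to the output. *)
have pO : universal_out 1 p.
  have in2 : tensor_universal e -> universal_in 2 p -> universal_out 1 p.
    by move=> [eL _] /(universal_in2_iff_out unitX pP eL).
  have in1 : tensor_universal e' -> universal_in 1 p -> universal_out 1 p.
    by move=> [_ e'R] /(universal_in1_iff_out unitX pP e'R).
  by case: pU eT => -[p1 p2] [] [t1 t2]; auto.
have [tu tu' tu''] : [/\ tensor_universal e, tensor_universal e'
    & tensor_universal e''].
  case: eT => -[t1 t2]; split=> //.
  - exact: tensor_universal_comp pP pO t1 t2.
  - exact: tensor_universal_cancel_left pP pO t1 t2.
  exact: tensor_universal_cancel_right pP pO t1 t2.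
split=> //; have [pI pOut] := pP; split=> i.
  rewrite pI => /=; case: i => [|[|[|i]]] // _.
    exact/(universal_in1_iff_out unitX pP tu'.2).
  exact/(universal_in2_iff_out unitX pP tu.1).
by rewrite pOut; case: i => [|[|i]].
Qed.
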